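(* For $t=[t_0:t_1]\in\mathbb{P}^1$, the point $[P_{\mathrm{nod},t}]\in\operatorname{Gr}(7,16)=\operatorname{Gr}(7,S^{+})$ is $T$-semistable, with respect to the maximal torus $T\subset\operatorname{Spin}(10)$ that is the lift of the diagonal maximal torus in $\operatorname{SO}(10)$, if and only if $t\notin\{1,\infty\}$ (that is, $t_0\neq t_1$ and $t_1\ne0$).
   Context: Work over $\mathbb{C}$. Let $V=\mathbb{C}^{10}$ with basis $e_{-1},\dots,e_{-5},e_1,\dots,e_5$ and quadratic form $Q=\sum_{i=1}^5z_{-i}z_i$, so that $\operatorname{SO}(10)=\operatorname{SO}(V,Q)$ has a maximal torus of diagonal matrices; $T$ is its preimage in $\operatorname{Spin}(10)$. The half-spin representation is $S^{+}=\bigwedge^{\mathrm{even}}\operatorname{Span}(e_1,\dots,e_5)$ (Clifford action: $e_i$ by left wedging, $e_{-i}$ by contraction against $e_i$), with basis $e_I=e_{i_1}\wedge\cdots\wedge e_{i_k}$, $I=\{i_1<\cdots<i_k\}\subset\{1,\dots,5\}$, $k$ even, $1=e_\emptyset$. Each $e_I$ is a $T$-weight vector of weight $\tfrac12\left(\sum_{i\in I}\varepsilon_i-\sum_{i\notin I}\varepsilon_i\right)$, where $\varepsilon_i$ is the weight of $e_i\in V$. $P_{\mathrm{nod},t}$ is the projectivization of the 7-dimensional subspace of $S^{+}$ spanned by $e_{12}+e_{13}$, $e_{24}$, $e_{34}$, $(t_0t_1-t_1^2)\cdot1+(t_0-t_1)e_{15}+t_1e_{23}+t_1e_{25}+t_0e_{35}$,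 $e_{23}+e_{25}+e_{45}$, $e_{1235}$, $e_{1345}$, for a chosen representative $(t_0,t_1)$ of $t$. $T$-semistability is with respect to the Plücker linearization $\operatorname{Gr}(7,S^{+})\subset\mathbb{P}(\bigwedge^7S^{+})$: $[P]$ is $T$-semistable if some homogeneous $T$-invariant polynomial of positive degree on $\bigwedge^7S^{+}$ does not vanish at $[P]$. *)

(* Defs.v *)
From mathcomp Require Import all_boot all_order all_algebra.
From mathcomp Require Import mpoly.
From mathcomp Require Import reals complex.

Set Implicit Arguments.
Unset Strict Implicit.
Unset Printing Implicit Defensive.

Import GRing.Theory Num.Theory.

Local Open Scope ring_scope.

(* Indices {1, ..., 5} are the ordinals {0, ..., 4} : 'I_5, shifted by one.
   All matrices act on column vectors. *)

Section Spin10.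

Variable K : numClosedFieldType.

(* For v in V, the coordinate z_{-i} is v (lshift 5 i) 0 and the coordinate z_i
   is v (rshift 5 i) 0. *)
Definition quad (v : 'cV[K]_(5 + 5)) : K :=
  \sum_(i < 5) v (lshift 5 i) 0 * v (rshift 5 i) 0.

Definition SO10 (A : 'M[K]_(5 + 5)) : Prop :=
  (forall v, quad (A *m v) = quad v) /\ \det A = 1.

(* The full spinor module S = /\ Span(e_1, ..., e_5) consists of the column
   vectors of coordinates in the basis e_I, I a subset of 'I_5. *)
Notation nS := #|{set 'I_5}|.

Definition ins_sign (i : 'I_5) (I : {set 'I_5}) : K :=
  (-1) ^+ #|[set j in I | (j < i)%N]|.

Definition wedge_mx (i : 'I_5) : 'M[K]_nS :=
  \matrix_(a, b) (let J : {set 'I_5} := enum_val a in let I : {set 'I_5} := enum_val b in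
    if (i \notin I) && (J == i |: I) then ins_sign i I else 0).

Definition contract_mx (i : 'I_5) : 'M[K]_nS :=
  \matrix_(a, b) (let J : {set 'I_5} := enum_val a in let I : {set 'I_5} := enum_val b in
    if (i \in I) && (J == I :\ i) then ins_sign i I else 0).

Definition cliff (v : 'cV[K]_(5 + 5)) : 'M[K]_nS :=
  \sum_(i < 5) (v (rshift 5 i) 0 *: wedge_mx i
                + v (lshift 5 i) 0 *: contract_mx i).

(* Since dim V is even, the Clifford algebra Cl(V, Q), with v * v = Q v, is
   the whole endomorphism algebra of S.  Spin(10) is the subset of the
   products of an even number of vectors v with Q v = 1. *)
Definition Spin10 (g : 'M[K]_nS) : Prop :=
  exists s : seq 'cV[K]_(5 + 5),
    [/\ ~~ odd (size s), all (fun v => quad v == 1) s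
      & g = \prod_(v <- s) cliff v].

(* The covering Spin(10) -> SO(10): g maps to A when g v g^-1 = A v in the
   Clifford algebra, for all v in V. *)
Definition covers (g : 'M[K]_nS) (A : 'M[K]_(5 + 5)) : Prop :=
  forall v, g *m cliff v = cliff (A *m v) *m g.

Definition odd_index (a : 'I_nS) : bool := odd #|(enum_val a : {set 'I_5})|.

Lemma cliff_parity v a b : odd_index a = odd_index b -> cliff v a b = 0.
Proof.
rewrite /odd_index => eq_ab; rewrite /cliff summxE; apply: big1 => i _.
rewrite !mxE /=; case: ifP => [/andP[i_notin /eqP eq_a]|_].
  by move: eq_ab; rewrite eq_a cardsU1 i_notin oddD /=; case: (odd _).
case: ifP => [/andP[i_in /eqP eq_a]|_]; last by rewrite !mulr0 addr0.
move: eq_ab; rewrite eq_a [in RHS](cardsD1 i) i_in oddD /=.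
by case: (odd _).
Qed.

Lemma Spin10_parity g a b :
  Spin10 g -> odd_index a != odd_index b -> g a b = 0.
Proof.
case=> s [/negPf s_even _ ->] neq_ab.
have {neq_ab s_even} : odd_index a (+) odd_index b != odd (size s).
  by rewrite s_even; move: neq_ab; case: odd_index; case: odd_index.
elim: s a b => [|v s IHs] a b /=.
  by rewrite big_nil mxE; case: (eqVneq a b) => // ->; rewrite addbb.
rewrite big_cons mxE => neq_ab; apply: big1 => c _.
have [/cliff_parity ->|neq_ac] := eqVneq (odd_index a) (odd_index c).
  by rewrite mul0r.
rewrite (IHs c b) ?mulr0 //; move: neq_ab neq_ac.
by case: (odd_index a); case: (odd_index b); case: (odd_index c); case: (odd _).
Qed.

Definition torusT (g : 'M[K]_nS) : Prop :=
  Spin10 g /\ exists d : 'rV[K]_(5 + 5), SO10 (diag_mx d) /\ covers g (diag_mx d).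

Definition even_sets : {set {set 'I_5}} := [set I : {set 'I_5} | ~~ odd #|I|].

Notation nSp := #|even_sets|.

(* The diagonal block on S^+ of an operator on S; elements of Spin(10)
   preserve S^+, see Spin10_parity. *)
Definition half_spin (g : 'M[K]_nS) : 'M[K]_nSp :=
  \matrix_(a, b) g (enum_rank (enum_val a)) (enum_rank (enum_val b)).

(* eS [:: i1; ...; ik] is e_{i1...ik}, for 1 <= i1 < ... < ik <= 5, k even. *)
Definition eS (s : seq nat) : 'cV[K]_nSp :=
  \col_a (enum_val a == [set k : 'I_5 | k.+1 \in s])%:R.

(* The basis of /\^k K^n is indexed by the k-element subsets of 'I_n, and
   ext_mx k M is the matrix of /\^k M, made of the k-minors of M. *)
Definition ksub (n k : nat) : {set {set 'I_n}} := [set A : {set 'I_n} | #|A| == k].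

Fact card_ksub (n k : nat) (a : 'I_#|ksub n k|) : k = #|enum_val a|.
Proof. by have := enum_valP a; rewrite inE => /eqP. Qed.

Definition ksub_nth (n k : nat) (a : 'I_#|ksub n k|) (i : 'I_k) : 'I_n :=
  enum_val (cast_ord (card_ksub a) i).

Definition ext_mx (k m n : nat) (M : 'M[K]_(m, n)) :
    'M[K]_(#|ksub m k|, #|ksub n k|) :=
  \matrix_(a, b) \det (mxsub (ksub_nth a) (ksub_nth b) M).

(* The coordinates of X_0 /\ ... /\ X_{k-1}. *)
Definition wedge_tuple (k n : nat) (X : k.-tuple 'cV[K]_n) :
    'cV[K]_#|ksub n k| :=
  \col_a \det (\matrix_(i < k, j < k) tnth X j (ksub_nth a i) 0).

Notation nP := #|ksub nSp 7|.

Definition T_invariant (f : {mpoly K[nP]}) : Prop :=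
  forall g, torusT g -> forall w : 'cV[K]_nP,
    f.@[fun i => (ext_mx 7 (half_spin g) *m w) i 0] = f.@[fun i => w i 0].

(* The point of Gr(7, S^+) is the subspace U itself, of dimension 7; its
   Pluecker image is represented by the wedge of any basis X of U, and the
   non-vanishing of the homogeneous f does not depend on X. *)
Definition T_semistable (U : {vspace 'cV[K]_nSp}) : Prop :=
  exists (d : nat) (f : {mpoly K[nP]}),
    [/\ (0 < d)%N, f \is d.-homog, T_invariant f
      & exists2 X : 7.-tuple 'cV[K]_nSp,
          basis_of U X & f.@[fun i => wedge_tuple X i 0] != 0].

Definition P_nod (t0 t1 : K) : {vspace 'cV[K]_nSp} :=
  span [:: eS [:: 1; 2]%N + eS [:: 1; 3]%N;
        eS [:: 2; 4]%N;
        eS [:: 3; 4]%N;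
        (t0 * t1 - t1 ^+ 2) *: eS [::]%N + (t0 - t1) *: eS [:: 1; 5]%N
          + t1 *: eS [:: 2; 3]%N + t1 *: eS [:: 2; 5]%N + t0 *: eS [:: 3; 5]%N;
        eS [:: 2; 3]%N + eS [:: 2; 5]%N + eS [:: 4; 5]%N;
        eS [:: 1; 2; 3; 5]%N;
        eS [:: 1; 3; 4; 5]%N].

End Spin10.

(* Main.v *)
(* An element g of T covering diag(d) acts on e_I by c * prod_(i in I) d_i, so the
   Pluecker coordinates are T-weight vectors.  If t0 <> t1 and t1 <> 0, a product
   of four non-vanishing Pluecker coordinates has weight a power of
   c^2 * prod_i d_i, a root of unity, and a power of it is invariant.  Otherwise
   (t0 - t1) t1 = 0, the vector 1 drops out and the subspace is graded by |I|; the
   one-parameter subgroup of T acting by s^(2|I| - 5) then multiplies the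
   Pluecker point by a nontrivial power of s, so that every invariant form of
   positive degree vanishes there. *)
Require Import Defs.
From mathcomp Require Import all_boot all_order all_algebra.
From mathcomp Require Import mpoly.
From mathcomp Require Import reals complex.
From mathcomp Require Import ring.

Set Implicit Arguments.
Unset Strict Implicit.
Unset Printing Implicit Defensive.

Import GRing.Theory Num.Theory.

Local Open Scope ring_scope.

(** * Symmetric difference of a finite set with a singleton *)

Section Toggle.

Variable T : finType.

Definition toggle (i : T) (I : {set T}) : {set T} :=
  if i \in I then I :\ i else i |: I.

Lemma in_toggle i j I : (j \in toggle i I) = (j == i) (+) (j \in I).
Proof.
rewrite /toggle; case: ifP => iI; rewrite !inE;
  by case: eqVneq => // ->; rewrite iI.
Qed.

Lemma toggleK i : involutive (toggle i).
Proof. by move=> I; apply/setP => j; rewrite !in_toggle addKb. Qed.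

Lemma toggleC i j I : toggle i (toggle j I) = toggle j (toggle i I).
Proof. by apply/setP => k; rewrite !in_toggle addbCA. Qed.

Lemma odd_card_toggle i I : odd #|toggle i I| = ~~ odd #|I|.
Proof.
rewrite /toggle; case: ifP => iI; first by rewrite (cardsD1 i I) iI /= negbK.
by rewrite cardsU1 iI.
Qed.

End Toggle.

(** * Matrices of the Clifford generators and the Clifford relations *)

Section Clifford.

Variable K : numClosedFieldType.

Notation nS := #|{set 'I_5}|.

(** The sign counts the elements below [i], and toggling [j] changes the parity of that count
    exactly when [j < i]. *)
Lemma ins_sign_toggle (i j : 'I_5) (I : {set 'I_5}) :
  ins_sign K i (toggle j I) = (-1) ^+ (j < i)%N * ins_sign K i I.
Proof.
rewrite /ins_sign -signr_odd -[in RHS](signr_odd _ #|_|) -signr_addb.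
suff -> : [set k in toggle j I | (k < i)%N] =
    if (j < i)%N then toggle j [set k in I | (k < i)%N]
    else [set k in I | (k < i)%N].
  by case: ifP => ji; rewrite ?odd_card_toggle.
apply/setP => k; case: ifP => ji; rewrite !(inE, in_toggle);
  by case: (eqVneq k j) => // ->; rewrite ji ?andbT ?andbF.
Qed.

Lemma ins_signK i I : ins_sign K i I * ins_sign K i I = 1.
Proof. by rewrite /ins_sign -expr2 sqrr_sign. Qed.

Lemma ins_sign_neq0 i I : ins_sign K i I != 0.
Proof. by rewrite /ins_sign signr_eq0. Qed.

(* [cgen true i] is the action of e_{-i} and [cgen false i] that of e_i: both
   toggle i in I.  The same convention indexes the coordinates [coordV]. *)
Definition cgen (b : bool) (i : 'I_5) : 'M[K]_nS :=
  if b then contract_mx K i else wedge_mx K i.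

Lemma cgenE b i p q :
  cgen b i p q = ((b == (i \in enum_val q)) && (enum_val p == toggle i (enum_val q)))%:R
                 * ins_sign K i (enum_val q).
Proof.
by rewrite /cgen /toggle; case: b; rewrite mxE /=; case: (i \in enum_val q) => /=;
  rewrite ?mul0r //; case: (_ == _); rewrite ?mul0r ?mul1r.
Qed.

Definition toggle_rank (i : 'I_5) (q : 'I_nS) : 'I_nS :=
  enum_rank (toggle i (enum_val q)).

Lemma toggle_rankK i : involutive (toggle_rank i).
Proof. by move=> q; rewrite /toggle_rank enum_rankK toggleK enum_valK. Qed.

Lemma eq_toggle_rank i p q :
  (enum_val p == toggle i (enum_val q)) = (p == toggle_rank i q).
Proof. by rewrite -(inj_eq enum_val_inj) enum_rankK. Qed.

(** Column [q] of a generator is supported on the single row [toggle_rank i q], so the sum over the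
    middle index has one term. *)
Lemma mul_cgenr (M : 'M[K]_nS) b i p q :
  (M *m cgen b i) p q =
  M p (toggle_rank i q) * ((b == (i \in enum_val q))%:R * ins_sign K i (enum_val q)).
Proof.
rewrite mxE (bigD1 (toggle_rank i q)) //= big1 ?addr0 => [|r /negPf rq].
  by rewrite cgenE eq_toggle_rank eqxx andbT.
by rewrite cgenE eq_toggle_rank rq andbF mul0r mulr0.
Qed.

Lemma mul_cgenl (M : 'M[K]_nS) b i p q :
  (cgen b i *m M) p q =
  (b != (i \in enum_val p))%:R * ins_sign K i (enum_val p) * M (toggle_rank i p) q.
Proof.
rewrite mxE (bigD1 (toggle_rank i p)) //= big1 ?addr0 => [|r rp].
  rewrite cgenE eq_toggle_rank toggle_rankK eqxx andbT enum_rankK in_toggle eqxx.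
  by rewrite ins_sign_toggle ltnn mul1r; case: b; case: (_ \in _).
rewrite cgenE eq_toggle_rank [p == _]eq_sym (can2_eq (toggle_rankK i) (toggle_rankK i)).
by rewrite (negPf rp) andbF !mul0r.
Qed.

(** If [i = j], both products vanish for [b = c], and for [b != c] exactly one survives on each e_I,
    with a squared sign. If [i != j], both products have the same support, and exactly one of
    [i < j] and [j < i] holds, so their signs are opposite. *)
Lemma cgen_anticomm b c i j :
  cgen b i *m cgen c j + cgen c j *m cgen b i = ((i == j) && (b != c))%:R%:M.
Proof.
apply/matrixP => p q; rewrite mxE !mul_cgenr [RHS]mxE !cgenE !enum_rankK.
rewrite !in_toggle !ins_sign_toggle toggleC.
case: (eqVneq i j) => [<-|ij] /=.
  rewrite toggleK (inj_eq enum_val_inj) ltnn mul1r.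
  have := ins_signK i (enum_val q); set e := ins_sign _ _ _ => ee.
  case: (p == q); rewrite /= ?andbT ?andbF ?mul0r ?addr0 ?mul0rn //.
  case: b; case: c; case: (i \in enum_val q) => /=;
    by rewrite ?(mul0r, mulr0, mul1r, addr0, add0r, ee).
rewrite mul0rn.
case: (_ == toggle _ _); rewrite /= ?andbT ?andbF ?mul0r ?addr0 //.
have := ij; rewrite -(inj_eq val_inj) /= neq_ltn.
by case: ltngtP => // _ _; rewrite ?expr1 ?expr0; ring.
Qed.

Definition coordV (v : 'cV[K]_(5 + 5)) (k : bool * 'I_5) : K :=
  v (if k.1 then lshift 5 k.2 else rshift 5 k.2) 0.

Lemma cliffE v : cliff v = \sum_k coordV v k *: cgen k.1 k.2.
Proof.
rewrite -(pair_bigA _ (fun b i => coordV v (b, i) *: cgen b i)) /=.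
by rewrite exchange_big; apply: eq_bigr => i _; rewrite big_bool addrC.
Qed.

Lemma cliff_linear a (v w : 'cV[K]_(5 + 5)) :
  cliff (a *: v + w) = a *: cliff v + cliff w.
Proof.
rewrite !cliffE scaler_sumr -big_split; apply: eq_bigr => k _ /=.
by rewrite /coordV !mxE scalerA scalerDl.
Qed.

Lemma cliff0 : cliff (0 : 'cV[K]_(5 + 5)) = 0.
Proof. by rewrite cliffE big1 // => k _; rewrite /coordV mxE scale0r. Qed.

(** The polarization of [quad] without the factor 1/2. *)
Definition polar (x y : 'cV[K]_(5 + 5)) : K :=
  \sum_k coordV x k * coordV y (~~ k.1, k.2).

Lemma cliff_anticomm x y :
  cliff x *m cliff y + cliff y *m cliff x = (polar x y)%:M.
Proof.
rewrite !cliffE [X in X + _]mulmx_suml [X in _ + X]mulmx_sumr -big_split /=.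
rewrite /polar raddf_sum; apply: eq_bigr => -[b i] _ /=.
(* Only the dual generator [(~~ b, i)] has a nonzero anticommutator with the generator [(b, i)]. *)
rewrite mulmx_suml mulmx_sumr -big_split /= (bigD1 (~~ b, i)) //= big1 ?addr0.
  rewrite -!scalemxAl -!scalemxAr !scalerA [in X in _ + X]mulrC -scalerDr.
  by rewrite cgen_anticomm eqxx; case: b; rewrite /= scale_scalar_mx mulr1.
case=> c j /= ne; rewrite -!scalemxAl -!scalemxAr !scalerA [in X in _ + X]mulrC.
rewrite -scalerDr cgen_anticomm.
suff -> : (i == j) && (b != c) = false by rewrite scale_scalar_mx mulr0 raddf0.
apply: contraNF ne => /andP[/eqP-> bc]; rewrite xpair_eqE eqxx andbT.
by case: b c bc => [] [].
Qed.

Lemma polar_diag (v : 'cV[K]_(5 + 5)) : polar v v = quad v *+ 2.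
Proof.
rewrite /polar -(pair_bigA _ (fun b i => coordV v (b, i) * coordV v (~~ b, i))) /=.
by rewrite big_bool /= mulr2n; congr (_ + _); apply: eq_bigr => i _; rewrite mulrC.
Qed.

Lemma cliff_sqr (v : 'cV[K]_(5 + 5)) : cliff v *m cliff v = (quad v)%:M.
Proof.
have := cliff_anticomm v v; rewrite polar_diag -mulr2n raddfMn /= => /eqP.
by rewrite -subr_eq0 -mulrnBl -scaler_nat scaler_eq0 pnatr_eq0 subr_eq0 => /eqP.
Qed.

(** By [cliff_sqr] each factor is an involution, hence has determinant 1 or -1. *)
Lemma Spin10_det (g : 'M[K]_nS) : Spin10 g -> \det g ^+ 2 = 1.
Proof.
case=> s [_ + ->]; elim: s => [_|v s IHs /= /andP[/eqP Qv /IHs Es]].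
  by rewrite big_nil det1 expr1n.
rewrite big_cons det_mulmx exprMn Es mulr1 expr2 -det_mulmx cliff_sqr Qv.
by rewrite det1.
Qed.

(** * Diagonal action of the torus on spinors *)

Definition torus_over (g : 'M[K]_nS) (d : 'rV[K]_(5 + 5)) : Prop :=
  [/\ Spin10 g, SO10 (diag_mx d) & covers g (diag_mx d)].

Lemma torusTP g : torusT g <-> exists d, torus_over g d.
Proof.
split=> [[gS [d [dSO gd]]]|[d [gS dSO gd]]]; first by exists d.
by split=> //; exists d.
Qed.

Definition basisV (k : bool * 'I_5) : 'cV[K]_(5 + 5) :=
  delta_mx (if k.1 then lshift 5 k.2 else rshift 5 k.2) 0.

Lemma cliff_basisV b i : cliff (basisV (b, i)) = cgen b i.
Proof.
rewrite cliffE (bigD1 (b, i)) //= big1 ?addr0.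
  by rewrite /coordV /basisV mxE !eqxx scale1r.
case=> c j ne; rewrite /coordV /basisV mxE /= eqxx andbT.
suff /negPf-> : (if c then lshift 5 j else rshift 5 j) !=
  (if b then lshift 5 i else rshift 5 i) by rewrite scale0r.
apply: contraNneq ne; case: b; case: c => /eqP;
 rewrite ?eq_lshift ?eq_rshift ?eq_lrshift ?eq_rlshift //;
 by move/eqP->.
Qed.

Definition coordD (d : 'rV[K]_(5 + 5)) (b : bool) (i : 'I_5) : K :=
  d 0 (if b then lshift 5 i else rshift 5 i).

(** Basis vectors of V are eigenvectors of [diag_mx d], so the covering identity becomes commutation
    up to a scalar. *)
Lemma covers_cgen (g : 'M[K]_nS) d b i : covers g (diag_mx d) ->
  g *m cgen b i = coordD d b i *: (cgen b i *m g).
Proof.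
move=> /(_ (basisV (b, i))).
suff -> : diag_mx d *m basisV (b, i) = coordD d b i *: basisV (b, i).
  rewrite -[_ *: _]addr0 cliff_linear cliff_basisV cliff0 addr0.
  by rewrite -scalemxAl.
apply/colP => k; rewrite mul_diag_mx !mxE eqxx andbT /coordD /=.
by case: eqP => [->|_]; rewrite ?mulr1 ?mulr0.
Qed.

(** This is entry [(p, q)] of [covers_cgen] for the one generator at [i] that does not kill the
    basis vector of index [q]. *)
Lemma covers_toggle (g : 'M[K]_nS) d i p q : covers g (diag_mx d) ->
  g p (toggle_rank i q) * ins_sign K i (enum_val q) =
  coordD d (i \in enum_val q) i *
   ((i \in enum_val q) != (i \in enum_val p))%:R * ins_sign K i (enum_val p) * g (toggle_rank i p) q.
Proof.
move=> /(covers_cgen (i \in enum_val q) i) /matrixP /(_ p q).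
rewrite mul_cgenr [RHS]mxE mul_cgenl eqxx mul1r => ->.
by rewrite !mulrA.
Qed.

(** In column [toggle_rank i q], the right side of [covers_toggle] vanishes unless the subsets of
    [p] and [q] agree at [i]. A nonzero entry thus forces agreement at every [i]. *)
Lemma covers_offdiag (g : 'M[K]_nS) d p q : covers g (diag_mx d) -> p != q -> g p q = 0.
Proof.
move=> gd; apply: contraNeq => gpq; apply/eqP/enum_val_inj/setP => i.
have := covers_toggle i p (toggle_rank i q) gd.
rewrite toggle_rankK !enum_rankK in_toggle eqxx /=.
case: (i \in _) => /=; case: (i \in _) => //= /eqP;
  by rewrite !(mulr0, mul0r) mulf_eq0 (negPf gpq) (negPf (ins_sign_neq0 _ _)).
Qed.

(** By induction on the cardinality of I: [covers_toggle] shows that the entries at I and [I :\ i]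
    differ by the factor d_i, the two signs being equal. *)
Lemma covers_diag (g : 'M[K]_nS) d p : covers g (diag_mx d) ->
  g p p = g (enum_rank set0) (enum_rank set0) *
          \prod_(i in enum_val p) coordD d false i.
Proof.
move=> gd; rewrite -{1 2}[p]enum_valK; move: (enum_val p) => {p} I.
have [n] := ubnP #|I|; elim: n I => // n IHn I.
have [->|[i iI]] := set_0Vmem I; first by rewrite big_set0 mulr1.
rewrite ltnS => leI.
have := covers_toggle i (enum_rank I) (enum_rank (I :\ i)) gd.
have -> : toggle_rank i (enum_rank I) = enum_rank (I :\ i).
  by rewrite /toggle_rank enum_rankK /toggle iI.
have -> : toggle_rank i (enum_rank (I :\ i)) = enum_rank I.
  by rewrite /toggle_rank enum_rankK /toggle setD11 setD1K.
rewrite !enum_rankK setD11 iI mulr1 (IHn (I :\ i)); last first.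
  by move: leI; rewrite (cardsD1 i) iI.
rewrite (_ : ins_sign K i (I :\ i) = ins_sign K i I); last first.
  have := ins_sign_toggle i i I.
  by rewrite /toggle iI ltnn mul1r.
rewrite (big_setD1 i iI) /= => /(congr1 ( *%R^~ (ins_sign K i I))).
rewrite -mulrA ins_signK mulr1 => ->.
have := ins_signK i I; set e := ins_sign K i I; set P := \prod_(_ in _) _.
set c := g _ _; set x := coordD _ _ _ => ee.
by transitivity (x * (c * P) * (e * e)); [ring | rewrite ee; ring].
Qed.

(* In fact c^2 * prod_i d_i = 1 (spinor norm), but \det g ^+ 2 = 1 alone shows that
   it is a root of unity, which is enough: pair each I with its complement. *)
Lemma torus_over_normal g d : torus_over g d ->
  exists c, (forall p, g p p = c * \prod_(i in enum_val p) coordD d false i) /\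
    (c ^+ 2 * \prod_i coordD d false i) ^+ nS = 1.
Proof.
move=> [gS _ gd]; exists (g (enum_rank set0) (enum_rank set0)).
have dg p := covers_diag p gd; split=> //.
have gE : g = diag_mx (\row_p g p p).
  apply/matrixP => p q; rewrite !mxE; case: eqVneq => [->//|pq]; exact: covers_offdiag gd pq.
have := Spin10_det gS; rewrite {1}gE det_diag; under eq_bigr do rewrite mxE dg.
rewrite expr2 [X in X * _](reindex_inj (h := fun p : 'I_nS => enum_rank (~: enum_val p))) /=; last first.
  by move=> p q /enum_rank_inj /setC_inj /enum_val_inj.
have split_prod (I : {set 'I_5}) : (\prod_(i in ~: I) coordD d false i) *
    (\prod_(i in I) coordD d false i) = \prod_i coordD d false i.
  rewrite [RHS](bigID (mem (~: I))) /=; congr (_ * _).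
  by apply: eq_bigl => i; rewrite inE negbK.
rewrite -big_split /=.
under eq_bigr do rewrite enum_rankK mulrACA -expr2 split_prod.
by rewrite prodr_const card_ord.
Qed.

(** * Torus elements built from pairs of reflections *)

Lemma Spin10_mul (g h : 'M[K]_nS) : Spin10 g -> Spin10 h -> Spin10 (g *m h).
Proof.
case=> s [s_even sQ ->] [r [r_even rQ ->]]; exists (s ++ r).
by rewrite size_cat oddD (negPf s_even) (negPf r_even) all_cat sQ rQ big_cat.
Qed.

Lemma covers_mul (g h : 'M[K]_nS) A B : covers g A -> covers h B -> covers (g *m h) (A *m B).
Proof. by move=> gA hB v; rewrite -(mulmxA g) hB (mulmxA g) gA mulmxA (mulmxA (cliff _)). Qed.

(** As [v] squares to 1, the anticommutator makes conjugation by [v] the negative of the reflection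
    in the hyperplane orthogonal to [v]. *)
Lemma cliff_reflection (v x : 'cV[K]_(5 + 5)) : quad v = 1 ->
  cliff v *m cliff x = cliff (polar v x *: v - x) *m cliff v.
Proof.
move=> Qv; rewrite cliff_linear -scaleN1r -[_ *: x]addr0 cliff_linear cliff0 addr0.
rewrite mulmxDl -scalemxAl cliff_sqr Qv -scalemxAl scaleN1r scale_scalar_mx mulr1.
by rewrite -cliff_anticomm addrK.
Qed.

Lemma coordV_diag d x b i :
  coordV (diag_mx d *m x) (b, i) = coordD d b i * coordV x (b, i).
Proof. by rewrite /coordV mul_diag_mx mxE. Qed.

(** Inverse eigenvalues on the z_{-i} half preserve each product z_{-i} z_i when all [u i] are
    nonzero. *)
Definition torus_row (u : 'I_5 -> K) : 'rV[K]_(5 + 5) :=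
  row_mx (\row_i (u i)^-1) (\row_i u i).

Lemma coordD_torus_row u b i :
  coordD (torus_row u) b i = if b then (u i)^-1 else u i.
Proof.
by rewrite /coordD /torus_row; case: b; rewrite ?row_mxEl ?row_mxEr mxE.
Qed.

Lemma eq_torus_row u v : u =1 v -> torus_row u = torus_row v.
Proof.
by move=> uv; congr row_mx; apply/rowP => i; rewrite !mxE uv.
Qed.

Lemma torus_row_mul u v :
  diag_mx (torus_row u) *m diag_mx (torus_row v) = diag_mx (torus_row (fun i => u i * v i)).
Proof.
rewrite mulmx_diag; congr diag_mx; apply/rowP => k; rewrite mxE.
case: (split_ordP k) => i ->; rewrite ?row_mxEl ?row_mxEr !mxE // invfM //.
Qed.

Lemma SO10_torus_row u : (forall i, u i != 0) -> SO10 (diag_mx (torus_row u)).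
Proof.
move=> u0; split=> [v|].
  apply: eq_bigr => i _; rewrite -/(coordV v (true, i)) -/(coordV v (false, i)).
  rewrite -/(coordV _ (true, i)) -/(coordV (_ *m v) (false, i)) !coordV_diag.
  by rewrite !coordD_torus_row mulrACA mulVf ?mul1r.
rewrite det_diag big_split_ord /= -big_split /= big1 // => i _.
have := coordD_torus_row u true i; have := coordD_torus_row u false i.
by rewrite /coordD /= => -> ->; rewrite mulVf.
Qed.

(** For [a != 0], a unit vector of the hyperbolic plane spanned by e_i and e_{-i}. *)
Definition hyp_vec (a : K) (i : 'I_5) : 'cV[K]_(5 + 5) :=
  a *: basisV (false, i) + a^-1 *: basisV (true, i).

Lemma coordV_basis k l : coordV (basisV k) l = (k == l)%:R.
Proof.
case: k l => [b i] [c j]; rewrite /coordV /basisV mxE eqxx andbT xpair_eqE /=.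
by case: b; case: c; rewrite ?(eq_lshift, eq_rshift, eq_lrshift, eq_rlshift) //= eq_sym.
Qed.

Lemma coordV_hyp_vec a i b j :
  coordV (hyp_vec a i) (b, j) = (i == j)%:R * (if b then a^-1 else a).
Proof.
have E k : coordV (hyp_vec a i) k = a * coordV (basisV (false, i)) k + a^-1 * coordV (basisV (true, i)) k.
  by rewrite /coordV !mxE.
rewrite E !coordV_basis !xpair_eqE.
by case: b; rewrite /= ?mulr0 ?addr0 ?add0r mulrC.
Qed.

Lemma polar_hyp_vec a i x :
  polar (hyp_vec a i) x = a * coordV x (true, i) + a^-1 * coordV x (false, i).
Proof.
rewrite /polar -(pair_bigA _ (fun b j => coordV (hyp_vec a i) (b, j) * coordV x (~~ b, j))) /=.
rewrite big_bool addrC; congr (_ + _).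
  rewrite (bigD1 i) //= big1 => [|j /negPf ji]; rewrite coordV_hyp_vec.
    by rewrite eqxx mul1r addr0.
  by rewrite eq_sym ji !mul0r.
rewrite (bigD1 i) //= big1 => [|j /negPf ji]; rewrite coordV_hyp_vec.
  by rewrite eqxx mul1r addr0.
by rewrite eq_sym ji !mul0r.
Qed.

Lemma quad_hyp_vec a i : a != 0 -> quad (hyp_vec a i) = 1.
Proof.
move=> a0; apply/eqP; rewrite -(eqr_pMn2r (n := 2)) //; apply/eqP.
rewrite -polar_diag polar_hyp_vec !coordV_hyp_vec eqxx !mul1r mulfV // mulVf //.
Qed.

Lemma coordVP v w : (forall b i, coordV v (b, i) = coordV w (b, i)) -> v = w.
Proof.
move=> vw; apply/colP => k; case: (split_ordP k) => i ->.
  exact: vw true i.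
exact: vw false i.
Qed.

(** Each of the two conjugations exchanges the lines of e_i and e_{-i}; their composite scales e_i
    by a^2 and e_{-i} by a^-2, and their signs cancel on the other basis vectors. *)
Lemma torus_over1 i a : a != 0 ->
  exists2 g, Spin10 g &
    covers g (diag_mx (torus_row (fun j => if j == i then a ^+ 2 else 1))).
Proof.
move=> a0; exists (cliff (hyp_vec a i) *m cliff (hyp_vec 1 i)).
  exists [:: hyp_vec a i; hyp_vec 1 i]; split=> //=.
    by rewrite !quad_hyp_vec ?oner_eq0 // !eqxx.
  by rewrite !big_cons big_nil mulr1.
move=> x; rewrite -mulmxA cliff_reflection ?quad_hyp_vec ?oner_eq0 //.
rewrite mulmxA cliff_reflection ?quad_hyp_vec // -mulmxA; congr (cliff _ *m _).
apply: coordVP => b j.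
have E c (v w : 'cV[K]_(5 + 5)) k : coordV (c *: v - w) k = c * coordV v k - coordV w k.
  by rewrite /coordV !mxE.
rewrite coordV_diag coordD_torus_row !E !polar_hyp_vec !E !coordV_hyp_vec eqxx eq_sym.
case: eqVneq => [->|ij]; case: b; rewrite /= ?invr1; field => //.
Qed.

Lemma torus_over_row a : a != 0 -> exists g, torus_over g (torus_row (fun=> a ^+ 2)).
Proof.
move=> a0.
(* Indices are added one at a time; [uniq s] prevents scaling one twice. *)
have H (s : seq 'I_5) : uniq s -> exists2 g, Spin10 g &
    covers g (diag_mx (torus_row (fun j => if j \in s then a ^+ 2 else 1))).
  elim: s => [_|i s IHs /= /andP[is_ /IHs [h hS hC]]].
    exists 1%:M; first by exists [::]; rewrite big_nil.
    move=> x; rewrite mul1mx mulmx1; congr cliff; apply: coordVP => b j.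
    by rewrite coordV_diag coordD_torus_row /= invr1 if_same mul1r.
  have [g gS gC] := torus_over1 i a0; exists (g *m h); first exact: Spin10_mul.
  have := covers_mul gC hC; rewrite torus_row_mul; congr (covers _ (diag_mx _)).
  apply: eq_torus_row => j; rewrite inE.
  by case: eqVneq => [->|_] /=; rewrite ?(negPf is_) ?mulr1 ?mul1r.
have [g gS gC] := H _ (enum_uniq 'I_5); exists g; split=> //.
  by apply: SO10_torus_row => i; rewrite expf_neq0.
move: gC; congr (covers _ (diag_mx _)); apply: eq_torus_row => j.
by rewrite mem_enum.
Qed.

End Clifford.

(** * Torus weights of Plücker coordinates, and criteria for semistability *)

Section Pluecker.

Variable K : numClosedFieldType.

Notation nS := #|{set 'I_5}|.
Notation nSp := #|even_sets|.
Notation nP := #|ksub nSp 7|.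

Lemma ksub_index n k (S : {set 'I_n}) : #|S| = k ->
  exists a : 'I_#|ksub n k|, enum_val a = S.
Proof.
move=> cS; have Sk : S \in ksub n k by rewrite inE cS.
by exists (enum_rank_in Sk S); rewrite enum_rankK_in.
Qed.

Lemma ksub_nth_inj n k (a : 'I_#|ksub n k|) : injective (ksub_nth a).
Proof. by move=> i j /enum_val_inj /cast_ord_inj. Qed.

Lemma ksub_nthP n k (a : 'I_#|ksub n k|) x :
  reflect (exists i, x = ksub_nth a i) (x \in enum_val a).
Proof.
apply: (iffP idP) => [xa|[i ->]]; last exact: enum_valP.
exists (cast_ord (esym (card_ksub a)) (enum_rank_in xa x)).
by rewrite /ksub_nth cast_ordKV enum_rankK_in.
Qed.

Lemma prod_ksub_nth n k (a : 'I_#|ksub n k|) (F : 'I_n -> K) :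
  \prod_(i < k) F (ksub_nth a i) = \prod_(x in enum_val a) F x.
Proof.
rewrite [RHS]big_enum_val /= (reindex (cast_ord (card_ksub a))) //=.
exists (cast_ord (esym (card_ksub a))) => i _; [exact: cast_ordK|exact: cast_ordKV].
Qed.

Lemma ext_mx_diag n k (h : 'rV[K]_n) :
  ext_mx k (diag_mx h) = diag_mx (\row_(a < #|ksub n k|) \prod_(x in enum_val a) h 0 x).
Proof.
apply/matrixP => a b; rewrite !mxE; case: eqVneq => [<-|ab].
  rewrite mulr1n -prod_ksub_nth.
  have -> : mxsub (ksub_nth a) (ksub_nth a) (diag_mx h) = diag_mx (\row_i h 0 (ksub_nth a i)).
    by apply/matrixP => i j; rewrite !mxE (inj_eq (@ksub_nth_inj _ _ a)).
  by rewrite det_diag; apply: eq_bigr => i _; rewrite mxE.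
rewrite mulr0n.
(* Of two distinct subsets of equal size, the first has an element outside the second; its row in
   the minor is zero. *)
have /subsetPn[x /ksub_nthP[i ->] xb] : ~~ (enum_val a \subset enum_val b).
  apply: contra ab => sab; rewrite -(inj_eq enum_val_inj) eqEcard sab.
  by rewrite -!card_ksub /=.
rewrite (expand_det_row _ i) big1 // => j _; rewrite !mxE.
case: eqVneq => [E|_]; last by rewrite mul0r.
by case/negP: xb; apply/ksub_nthP; exists j.
Qed.

Lemma torus_pluecker (g : 'M[K]_nS) d : torus_over g d ->
  exists c, (c ^+ 2 * \prod_i coordD d false i) ^+ nS = 1 /\
   forall (w : 'cV[K]_nP) a, (ext_mx 7 (half_spin g) *m w) a 0 =
    (\prod_(p in enum_val a) (c * \prod_(i in enum_val p) coordD d false i)) * w a 0.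
Proof.
move=> gd; have [c [gE cE]] := torus_over_normal gd; exists c; split=> // w a.
have -> : half_spin g =
    diag_mx (\row_(p < nSp) (c * \prod_(i in enum_val p) coordD d false i)).
  apply/matrixP => p q; rewrite !mxE; case: eqVneq => [<-|pq].
    by rewrite gE enum_rankK.
  case: gd => _ _ gC; apply: (covers_offdiag gC).
  by rewrite (inj_eq enum_rank_inj) (inj_eq enum_val_inj).
rewrite ext_mx_diag mul_diag_mx !mxE; congr (_ * _).
by apply: eq_bigr => p _; rewrite mxE.
Qed.

(** The hypothesis says that the square submatrix on the rows in [a] has trivial kernel, which makes
    the minor nonzero and the columns free. Coefficients are functions on [nat] so that explicit
    families can be handled by evaluation. *)
Lemma wedge_tuple_neq0 n k (X : k.-tuple 'cV[K]_n) (a : 'I_#|ksub n k|) :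
  (forall v : nat -> K,
     (forall x, x \in enum_val a -> \sum_(0 <= j < k) v j * X`_j x 0 = 0) ->
     forall j, (j < k)%N -> v j = 0) ->
  free X /\ wedge_tuple X a 0 != 0.
Proof.
move=> H.
have {}H (v : 'I_k -> K) :
    (forall x, x \in enum_val a -> \sum_j v j * X`_j x 0 = 0) -> forall j, v j = 0.
  (* Coefficients on ['I_k] are extended by 0 to [nat]. *)
  move=> vX j; have := H (fun n => oapp v 0 (insub n)) _ j (ltn_ord j).
  rewrite valK; apply=> x /vX; rewrite big_mkord => E; rewrite -[RHS]E.
  by apply: eq_bigr => l _; rewrite valK.
split.
  apply/freeP => v vX; apply: H => x _.
  have /colP/(_ x) := vX; rewrite summxE mxE => E; rewrite -[RHS]E.
  by apply: eq_bigr => j _; rewrite mxE.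
rewrite mxE -det_tr; apply/negP => /det0P[v vn0 vX]; case/negP: vn0.
apply/eqP/rowP => j; rewrite mxE; apply: (H (v 0)) => x /ksub_nthP[i ->].
have /rowP/(_ i) := vX; rewrite !mxE => E; rewrite -[RHS]E.
by apply: eq_bigr => l _; rewrite !mxE (tnth_nth 0).
Qed.

Lemma meval_dhomogZ n d (f : {mpoly K[n]}) q v :
  f \is d.-homog -> f.@[fun i => q * v i] = q ^+ d * f.@[v].
Proof.
move=> fd; rewrite !mevalE mulr_sumr [LHS]big_seq [RHS]big_seq.
apply: eq_bigr => m mf; rewrite mulrCA; congr (_ * _).
under eq_bigr do rewrite exprMn.
by rewrite big_split /= prodrXr -mdegE (dhomog_mf fd mf).
Qed.

(* A product of Pluecker coordinates in which every index occurs equally often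
   has weight (c^2 prod d_i)^m, a root of unity: its nS-th power is invariant. *)
Lemma balanced_semistable (U : {vspace 'cV[K]_nSp}) (X : 7.-tuple 'cV[K]_nSp)
    (s : seq 'I_nP) (m : nat) :
  basis_of U X -> (0 < m)%N -> (size s * 7 = m.*2)%N ->
  (forall i, \sum_(a <- s) #|[set p in enum_val a | i \in enum_val p]| = m)%N ->
  (forall a, a \in s -> wedge_tuple X a 0 != 0) ->
  T_semistable U.
Proof.
move=> UX m0 sm sE sX.
have fE w : (((\prod_(a <- s) 'X_a) ^+ nS : {mpoly K[nP]})).@[w] = (\prod_(a <- s) w a) ^+ nS.
  rewrite rmorphXn rmorph_prod /=; congr (_ ^+ _).
  by apply: eq_bigr => a _; rewrite mevalXU.
exists (size s * nS)%N, ((\prod_(a <- s) 'X_a) ^+ nS); split.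
- rewrite muln_gt0; apply/andP; split; first by case: (s) sm m0 => //; case: (m).
  by apply/card_gt0P; exists set0.
- apply: dhomogMn; elim: (s) => [|a r IH]; first by rewrite big_nil dhomog1.
  by rewrite big_cons (dhomogM (d := 1)) // dhomogX; apply/eqP/mdeg1.
- move=> g /torusTP[d gd] w; have [c [cE gE]] := torus_pluecker gd.
  rewrite !fE; under eq_bigr do rewrite gE.
  rewrite big_split exprMn /=; set u := coordD d false.
  suff -> : \prod_(a <- s) \prod_(p in enum_val a) (c * \prod_(i in enum_val p) u i) = (c ^+ 2 * \prod_i u i) ^+ m.
    by rewrite exprAC cE expr1n mul1r.
  (* Each coordinate contributes [c] once per member of its 7-set, and [u i] once per member
     containing [i]. *)
  transitivity (\prod_(a <- s) (c ^+ 7 * \prod_i u i ^+ #|[set p in enum_val a | i \in enum_val p]|)).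
    apply: eq_bigr => a _; rewrite big_split /= prodr_const -card_ksub; congr (_ * _).
    rewrite (exchange_big_dep xpredT) //=; apply: eq_bigr => i _.
    by rewrite prodr_const; congr (_ ^+ _); apply: eq_card => p; rewrite !inE.
  rewrite big_split /= exchange_big /= exprMn -!exprM prodrXr.
  rewrite big_const_seq count_predT iter_addn_0 mulnC sm -mul2n; congr (_ * _).
  by rewrite -prodrXl; apply: eq_bigr => i _; rewrite prodrXr sE.
- exists X => //; rewrite fE expf_neq0 // prodf_seq_neq0.
  by apply/allP => a /sX.
Qed.

(* The one-parameter subgroup acting on /\^k Span(e_1, ..., e_5) with weight
   2k - 5 rescales the Pluecker point of such a subspace; the exponent is odd,
   hence nonzero, since the dimension 7 and the rank 5 are odd. *)
Lemma graded_not_semistable (b : 7.-tuple 'cV[K]_nSp) (m : 'I_7 -> nat) :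
  (forall j p, tnth b j p 0 != 0 -> #|enum_val p| = m j) ->
  ~ T_semistable (span b).
Proof.
move=> bm [d [f [d0 fd fT [X XU]]]]; apply/negP; rewrite negbK.
(* The value 2 gives an element over the scaling of every e_i by 4, which is not a root of unity. *)
have u0 : (2 : K) != 0 by rewrite pnatr_eq0.
have [g gd] := torus_over_row u0; have [c [cE gE]] := torus_pluecker gd.
have gT : torusT g by apply/torusTP; exists (torus_row (fun=> 2 ^+ 2)).
have {}cE : (c ^+ 2 * 4 ^+ 5) ^+ nS = 1.
  rewrite -[RHS]cE; congr ((_ * _) ^+ _); rewrite -[in LHS](card_ord 5) -prodr_const.
  by apply: eq_bigr => i _; rewrite coordD_torus_row -natrX.
set M := (\sum_j m j)%N.
have uE (I : {set 'I_5}) : \prod_(i in I) coordD (torus_row (fun=> 2 ^+ 2)) false i = 4 ^+ #|I| :> K.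
  rewrite -prodr_const; apply: eq_bigr => i _; rewrite coordD_torus_row.
  by rewrite -natrX.
have scale a : (ext_mx 7 (half_spin g) *m wedge_tuple X) a 0 =
    c ^+ 7 * 4 ^+ M * wedge_tuple X a 0.
  rewrite gE big_split /= prodr_const -card_ksub -[LHS]mulrA -[RHS]mulrA; congr (_ * _).
  under eq_bigr do rewrite uE.
  (* [B] holds the rows in [a] of the graded family and [C] the coordinates in it of the arbitrary
     basis [X]. *)
  set B := \matrix_(i < 7, k < 7) tnth b k (ksub_nth a i) 0.
  set C := \matrix_(k < 7, j < 7) coord b k (tnth X j).
  have -> : wedge_tuple X a 0 = \det (B *m C).
    rewrite mxE; congr (\det _); apply/matrixP => i j; rewrite !mxE.
    have Xj : tnth X j \in span b.
      by rewrite -(span_basis XU) memv_span ?mem_tnth.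
    rewrite {1}(coord_span Xj) summxE; apply: eq_bigr => k _.
    by rewrite !mxE -tnth_nth mulrC.
  rewrite -(prod_ksub_nth a (fun p => 4 ^+ #|enum_val p|)) /=.
  have -> : \prod_(i < 7) 4 ^+ #|enum_val (ksub_nth a i)| =
     \det (diag_mx (\row_(i < 7) (4 ^+ #|enum_val (ksub_nth a i)| : K))).
    by rewrite det_diag; apply: eq_bigr => i _; rewrite mxE.
  have -> : 4 ^+ M = \det (diag_mx (\row_(i < 7) (4 ^+ m i : K))).
    by rewrite det_diag -prodrXr; apply: eq_bigr => i _; rewrite mxE.
  (* A nonzero entry in column [j] of [B] lies in a row of degree [m j], so scaling rows by degree
     is scaling columns. *)
  have gradedB : diag_mx (\row_i 4 ^+ #|enum_val (ksub_nth a i)|) *m B =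
      B *m diag_mx (\row_i 4 ^+ m i).
    apply/matrixP => i j; rewrite mul_diag_mx mul_mx_diag !mxE mulrC.
    by have [->|/bm ->] := eqVneq (tnth b j (ksub_nth a i) 0) 0; rewrite ?mul0r.
  rewrite [\det (B *m C)]det_mulmx !mulrA -det_mulmx gradedB det_mulmx.
  by rewrite [\det B * _]mulrC.
have := fT g gT (wedge_tuple X); under meval_eq do rewrite scale.
rewrite (meval_dhomogZ _ _ fd); set y := f.@[_]; set q := c ^+ 7 * _ => qy.
apply: contra_eqT qy => y0; rewrite -subr_eq0 -[X in _ - X]mul1r -mulrBl mulf_eq0 negb_or y0 andbT.
rewrite subr_eq0; apply/eqP => qd.
(* The relation [cE], raised to the power [7 * d], eliminates [c] from the [2 * nS]-th power of
   [q ^+ d = 1]. Comparing exponents of 4 gives 35 = 2M, against parity. *)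
have : (4 : K) ^+ (35 * (nS * d)) = 4 ^+ (M.*2 * (nS * d)).
  have -> : (4 : K) ^+ (M.*2 * (nS * d)) = q ^+ d ^+ (2 * nS) * 4 ^+ (35 * (nS * d)).
    transitivity (((c ^+ 2 * 4 ^+ 5) ^+ nS) ^+ (7 * d) * (4 : K) ^+ (M.*2 * (nS * d))).
      by rewrite cE expr1n mul1r.
    have expM (x z : K) k l e : (x ^+ k * z ^+ l) ^+ e = x ^+ (k * e) * z ^+ (l * e).
      by rewrite exprMn -!exprM.
    rewrite -2!exprM !expM mulrAC -mul2n.
    by congr (_ * _ * _); congr (_ ^+ _); ring.
  by rewrite qd expr1n mul1r.
move/eqP; rewrite -!natrX eqr_nat eqn_exp2l // eqn_mul2r muln_eq0.
have /negPf-> : nS != 0%N by rewrite -lt0n; apply/card_gt0P; exists set0.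
by rewrite eqn0Ngt d0 => /eqP /(congr1 odd); rewrite odd_double.
Qed.

End Pluecker.

(** * The nodal pencil in explicit coordinates *)

Section NodalPencil.

Variable K : numClosedFieldType.

Notation nS := #|{set 'I_5}|.
Notation nSp := #|even_sets|.
Notation nP := #|ksub nSp 7|.

Definition sset (s : seq nat) : {set 'I_5} := [set k : 'I_5 | k.+1 \in s].

(** A characteristic vector that evaluates, so that equality and cardinality of explicit subsets are
    decided by computation. *)
Definition bits (s : seq nat) : seq bool := [seq k \in s | k <- iota 1 5].

Lemma bits_sset s : bits s = [seq k \in sset s | k <- enum 'I_5].
Proof.
rewrite /bits (iotaDl 1 0) -val_enum_ord -!map_comp.
by apply: eq_map => k; rewrite /= inE.
Qed.

Lemma eq_sset s r : (sset s == sset r) = (bits s == bits r).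
Proof.
apply/eqP/eqP => [E|]; first by rewrite !bits_sset E.
rewrite !bits_sset => /eq_in_map E; apply/setP => k.
by apply: E; rewrite mem_enum.
Qed.

Lemma card_sset s : #|sset s| = count id (bits s).
Proof.
rewrite bits_sset count_map -size_filter.
rewrite -(card_uniqP (filter_uniq _ (enum_uniq _))).
by apply: eq_card => k; rewrite mem_filter mem_enum andbT.
Qed.

Fact set0_even : set0 \in even_sets.
Proof. by rewrite inE cards0. Qed.

(** Meaningful only under [ev s]; for an odd subset the index is an arbitrary default. *)
Definition idx (s : seq nat) : 'I_nSp := enum_rank_in set0_even (sset s).

Definition ev (s : seq nat) : bool := ~~ odd (count id (bits s)).

Lemma idxK s : ev s -> enum_val (idx s) = sset s.
Proof. by move=> es; rewrite enum_rankK_in // inE card_sset. Qed.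

Lemma eS_idx s r : ev s -> eS K r (idx s) 0 = (bits s == bits r)%:R.
Proof. by move=> es; rewrite mxE idxK // -/(sset r) eq_sset. Qed.

Lemma uniq_idx L : all ev L -> uniq [seq bits s | s <- L] -> uniq [seq idx s | s <- L].
Proof.
move=> /allP evL uL.
(* [bits s] is recovered from [idx s], so distinct bit vectors force distinct indices. *)
apply: (@map_uniq _ _ (fun p => [seq k \in (enum_val p : {set 'I_5}) | k <- enum 'I_5])).
rewrite -map_comp; congr uniq: uL; apply/eq_in_map => s /evL es.
by rewrite /= idxK // bits_sset.
Qed.

Lemma pluecker_index L : size L = 7 -> all ev L -> uniq [seq bits s | s <- L] ->
  exists a : 'I_nP, enum_val a = [set p in [seq idx s | s <- L]] /\
    forall i : 'I_5, #|[set p in enum_val a | i \in enum_val p]| = count (fun s => i.+1 \in s) L.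
Proof.
move=> sL evL uL; have := uniq_idx evL uL; set r := map _ L => ur.
have [|a aE] := @ksub_index nSp 7 [set p in r].
  by rewrite cardsE (card_uniqP ur) size_map.
exists a; split=> // i; rewrite aE.
transitivity (count (fun p : 'I_nSp => i \in enum_val p) r).
  rewrite -size_filter -(card_uniqP (filter_uniq _ ur)).
  by apply: eq_card => p; rewrite !inE mem_filter andbC.
rewrite count_map; apply: eq_in_count => s sL' /=.
by rewrite idxK ?(allP evL) // inE.
Qed.

Definition graded (k : nat) (v : 'cV[K]_nSp) : Prop :=
  forall p, v p 0 != 0 -> #|enum_val p| = k.

Lemma gradedD k v w : graded k v -> graded k w -> graded k (v + w).
Proof.
move=> gv gw p; rewrite mxE; have [->|/gv//] := eqVneq (v p 0) 0.
by rewrite add0r => /gw.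
Qed.

Lemma gradedZ k c v : graded k v -> graded k (c *: v).
Proof. by move=> gv p; rewrite mxE mulf_eq0 negb_or => /andP[_ /gv]. Qed.

Lemma graded_eS s : graded (count id (bits s)) (eS K s).
Proof.
move=> p; rewrite mxE -/(sset s); case: (enum_val p =P sset s) => [->|_]; first by rewrite card_sset.
by rewrite eqxx.
Qed.

Variables t0 t1 : K.

Definition nod_basis : 7.-tuple 'cV[K]_nSp :=
  [tuple eS K [:: 1; 2]%N + eS K [:: 1; 3]%N;
        eS K [:: 2; 4]%N;
        eS K [:: 3; 4]%N;
        (t0 * t1 - t1 ^+ 2) *: eS K [::]%N + (t0 - t1) *: eS K [:: 1; 5]%N
          + t1 *: eS K [:: 2; 3]%N + t1 *: eS K [:: 2; 5]%N + t0 *: eS K [:: 3; 5]%N;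
        eS K [:: 2; 3]%N + eS K [:: 2; 5]%N + eS K [:: 4; 5]%N;
        eS K [:: 1; 2; 3; 5]%N;
        eS K [:: 1; 3; 4; 5]%N].

Lemma nod_basis_coord s (v : nat -> K) : ev s ->
  let e r := (bits s == bits r)%:R in
  \sum_(0 <= j < 7) v j * nod_basis`_j (idx s) 0 =
    v 0 * (e [:: 1; 2]%N + e [:: 1; 3]%N) + v 1 * e [:: 2; 4]%N + v 2 * e [:: 3; 4]%N
    + v 3 * ((t0 - t1) * t1 * e [::] + (t0 - t1) * e [:: 1; 5]%N
          + t1 * e [:: 2; 3]%N + t1 * e [:: 2; 5]%N + t0 * e [:: 3; 5]%N)
    + v 4 * (e [:: 2; 3]%N + e [:: 2; 5]%N + e [:: 4; 5]%N)
    + v 5 * e [:: 1; 2; 3; 5]%N + v 6 * e [:: 1; 3; 4; 5]%N.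
Proof.
move=> es e; have E r : eS K r (idx s) 0 = e r by exact: eS_idx.
have D (x y : 'cV[K]_nSp) p : (x + y) p 0 = x p 0 + y p 0 by rewrite mxE.
have Z c (x : 'cV[K]_nSp) p : (c *: x) p 0 = c * x p 0 by rewrite mxE.
rewrite /index_iota /= !big_cons big_nil /= !(D, Z, E); ring.
Qed.

(** Each of these subsets occurs in exactly one generator and is all of it, so its coordinate
    isolates one of the coefficients [v 1], [v 2], [v 5], [v 6]. *)
Definition common_chart : seq (seq nat) := [:: [:: 2; 4]; [:: 3; 4]; [:: 1; 2; 3; 5]; [:: 1; 3; 4; 5]]%N.

(* Each completed by [common_chart]: these four 7-sets of weights have barycenter 0,
   every index occurring 14 times among their 28 subsets. *)
Definition nod_charts : seq (seq (seq nat)) :=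
  [:: [:: [:: 1; 2]; [:: 2; 5]; [:: 4; 5]];
      [:: [:: 1; 2]; [::]; [:: 2; 5]];
      [:: [:: 1; 2]; [:: 1; 5]; [:: 4; 5]];
      [:: [:: 1; 3]; [:: 1; 5]; [:: 2; 3]]]%N.

Lemma nod_pluecker L : t0 != t1 -> t1 != 0 -> L \in nod_charts ->
  exists a : 'I_nP, [/\ (forall i : 'I_5,
     #|[set p in enum_val a | i \in enum_val p]| = count (fun s => i.+1 \in s) (common_chart ++ L)),
     free nod_basis & wedge_tuple nod_basis a 0 != 0].
Proof.
move=> t01 t1n0 LB.
have [sL evL uL] : [/\ size (common_chart ++ L) = 7, all ev (common_chart ++ L)
    & uniq [seq bits s | s <- common_chart ++ L]].
  by move: LB; rewrite !inE => /or4P[] /eqP->.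
have [a [aE aC]] := pluecker_index sL evL uL.
exists a; suff [fX wX] : free nod_basis /\ wedge_tuple nod_basis a 0 != 0 by [].
apply: wedge_tuple_neq0 => v vX.
have {}vX s : s \in common_chart ++ L -> ev s -> \sum_(0 <= j < 7) v j * nod_basis`_j (idx s) 0 = 0.
  by move=> sin _; apply: vX; rewrite aE inE map_f.
have eval s (sin : s \in common_chart ++ L) (es : ev s) :=
  etrans (esym (nod_basis_coord v es)) (vX s sin es).
have u0 : t0 - t1 != 0 by rewrite subr_eq0.
have simp := (mulr0, mulr1, addr0, add0r).
have v1 : v 1 = 0 by have := eval [:: 2; 4]%N isT isT; rewrite /= !simp.
have v2 : v 2 = 0 by have := eval [:: 3; 4]%N isT isT; rewrite /= !simp.
have v5 : v 5 = 0 by have := eval [:: 1; 2; 3; 5]%N isT isT; rewrite /= !simp.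
have v6 : v 6 = 0 by have := eval [:: 1; 3; 4; 5]%N isT isT; rewrite /= !simp.
suff [v0 v3 v4] : [/\ v 0 = 0, v 3 = 0 & v 4 = 0].
  by do 7 (case=> //).
have nz x c : c != 0 -> x * c = 0 -> x = 0 :> K.
  by move=> c0 /eqP; rewrite mulf_eq0 (negPf c0) orbF => /eqP.
(* In each chart the system left for [v 0], [v 3], [v 4] is triangular. The pivot of [v 3] is [t1],
   [(t0 - t1) * t1], [t0 - t1], [t0 - t1] respectively; the other pivots are 1. *)
move: LB {aE aC vX} eval; rewrite !inE => /or4P[] /eqP-> eval.
- have := eval [:: 1; 2]%N isT isT; have := eval [:: 2; 5]%N isT isT.
  have := eval [:: 4; 5]%N isT isT; rewrite /= !simp => -> E ->.
  by split=> //; apply: nz t1n0 _; move: E; rewrite !simp.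
- have := eval [:: 1; 2]%N isT isT; have := eval [::]%N isT isT.
  have := eval [:: 2; 5]%N isT isT; rewrite /= !simp => + E ->.
  by have -> := nz _ _ (mulf_neq0 u0 t1n0) E; rewrite mul0r add0r.
- have := eval [:: 1; 2]%N isT isT; have := eval [:: 1; 5]%N isT isT.
  have := eval [:: 4; 5]%N isT isT; rewrite /= !simp => -> E ->.
  by split=> //; apply: nz u0 _.
- have := eval [:: 1; 3]%N isT isT; have := eval [:: 1; 5]%N isT isT.
  have := eval [:: 2; 3]%N isT isT; rewrite /= !simp => + E ->.
  by have -> := nz _ _ u0 E; rewrite mul0r add0r.
Qed.

Lemma nod_semistable : t0 != t1 -> t1 != 0 -> T_semistable (P_nod t0 t1).
Proof.
move=> t01 t1n0.
have nodP L := nod_pluecker t01 t1n0 (L := L).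
have [a [aC fX aX]] := nodP (nth [::] nod_charts 0) isT.
have [b [bC _ bX]] := nodP (nth [::] nod_charts 1) isT.
have [c [cC _ cX]] := nodP (nth [::] nod_charts 2) isT.
have [d [dC _ dX]] := nodP (nth [::] nod_charts 3) isT.
apply: (balanced_semistable (X := nod_basis) (s := [:: a; b; c; d]) (m := 14)) => //.
- by rewrite /basis_of fX andbT.
- move=> i; rewrite !big_cons big_nil aC bC cC dC.
  by case: i {aC bC cC dC} => [[|[|[|[|[|//]]]]]].
- by move=> x; rewrite !inE => /or4P[] /eqP->.
Qed.

Lemma nod_not_semistable : (t0 - t1) * t1 = 0 -> ~ T_semistable (P_nod t0 t1).
Proof.
move=> t01; apply: (graded_not_semistable (b := nod_basis)
  (m := nth 0 [:: 2; 2; 2; 2; 2; 4; 4] \o val)%N) => j.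
rewrite (tnth_nth 0); move: j.
have gS := graded_eS.
case=> [[|[|[|[|[|[|[|//]]]]]]]] _ /=.
- exact: gradedD (gS [:: 1; 2]%N) (gS [:: 1; 3]%N).
- exact: (gS [:: 2; 4]%N).
- exact: (gS [:: 3; 4]%N).
(* The coefficient of the vector 1 is [(t0 - t1) * t1]; once it vanishes, only terms of degree 2
   remain. *)
- rewrite expr2 -mulrBl t01 scale0r add0r.
  do 3 (apply: gradedD; last exact/gradedZ/gS).
  exact: gradedZ (gS [:: 1; 5]%N).
- exact: gradedD (gradedD (gS [:: 2; 3]%N) (gS [:: 2; 5]%N)) (gS [:: 4; 5]%N).
- exact: (gS [:: 1; 2; 3; 5]%N).
- exact: (gS [:: 1; 3; 4; 5]%N).
Qed.

End NodalPencil.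

Theorem proposition5p4 (R : realType) (t0 t1 : R[i])
    (t_neq0 : (t0, t1) <> (0, 0)) :
  T_semistable (P_nod t0 t1) <-> (t0 <> t1 /\ t1 <> 0).
Proof.
split=> [ss|[/eqP t01 /eqP t1n0]]; last exact: nod_semistable.
by split=> E; apply: nod_not_semistable ss; rewrite E ?subrr ?mul0r ?mulr0.
Qed.
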